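(* Let $P$ and $Q$ be probability distributions on $\mathsf Z$, and let $a_P,a_Q\in\mathsf A$ satisfy $H_\ell(P)=\mathbb E_P[\ell(Z,a_P)]$ and $H_\ell(Q)=\mathbb E_Q[\ell(Z,a_Q)]$. If $\mathrm{Var}_Q[\ell(Z,a_Q)]$ and $\mathrm{Var}_Q[\ell(Z,a_P)]$ exist, then $$H_\ell(P)-H_\ell(Q)\le\sqrt{\mathrm{Var}_Q[\ell(Z,a_Q)]\,\chi^2(P\|Q)}$$ and $$H_\ell(Q)-H_\ell(P)\le\sqrt{\mathrm{Var}_Q[\ell(Z,a_P)]\,\chi^2(P\|Q)}.$$
   Context: $\mathsf Z$ is a (measurable) space of outcomes, $\mathsf A$ a space of actions, $\ell:\mathsf Z\times\mathsf A\to\mathbb R$ a loss function. The generalized entropy of a distribution $P$ on $\mathsf Z$ is $H_\ell(P)=\inf_{a\in\mathsf A}\mathbb E_P[\ell(Z,a)]$, $Z\sim P$. It is assumed that the infimum is attained for the distributions considered. The $\chi^2$ divergence is $\chi^2(P\|Q)=\mathbb E_Q\big[(\frac{\mathrm dP}{\mathrm dQ}-1)^2\big]$ (so $P$ is absolutely continuous with respect to $Q$). *)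

(* Defs.v *)
From HB Require Import structures.
From mathcomp Require Export all_boot all_order all_algebra.
From mathcomp Require Export all_classical all_reals all_analysis.

Set Implicit Arguments.
Unset Strict Implicit.
Unset Printing Implicit Defensive.

Import Order.TTheory GRing.Theory Num.Theory.
Import numFieldNormedType.Exports.

Local Open Scope classical_set_scope.
Local Open Scope ring_scope.
Local Open Scope charge_scope.
Local Open Scope ereal_scope.

(* Extended-real valued, as ['E_P] is: the expected loss of an action may be
   infinite.  The integral is -oo when the positive and negative parts of the
   loss both have infinite expectation; actions whose expected loss under [P]
   is meaningful get their usual expected loss. *)
Definition gen_entropy d (Z : measurableType d) (R : realType) (A : Type)
    (loss : Z -> A -> R) (P : probability Z R) : \bar R :=
  ereal_inf [set 'E_P[loss ^~ a] | a in [set: A]].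

(* Integrability is required separately because the library's variance is
   centred at [fine 'E_P[X]], which is a junk value when the mean is not
   finite. *)
Definition has_variance d (Z : measurableType d) (R : realType)
    (P : probability Z R) (X : Z -> R) : Prop :=
  P.-integrable [set: Z] (EFin \o X) /\ 'V_P[X] < +oo.

(* Meaningful for [P `<< Q]; possibly +oo. *)
Definition chi2_div d (Z : measurableType d) (R : realType)
    (P Q : probability Z R) : \bar R :=
  \int[Q]_z (('d (charge_of_finite_measure P) '/d Q) z - 1) ^+ 2.

(* Main.v *)
Require Import Defs.
From mathcomp Require Import measurable_realfun.

Set Implicit Arguments.
Unset Strict Implicit.
Unset Printing Implicit Defensive.

Import Order.TTheory GRing.Theory Num.Theory.
Import numFieldNormedType.Exports.

Local Open Scope classical_set_scope.
Local Open Scope ring_scope.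
Local Open Scope ereal_scope.

(** Each difference of entropies is bounded, by minimality, by the difference
    of the expectations under [P] and [Q] of a single loss [X].  With
    [Y = dP/dQ], that difference is the covariance of [X] and [Y] under [Q]
    since [E_Q[Y] = 1], and Cauchy-Schwarz applies, the variance of [Y] being
    the chi-square divergence.  When the divergence is infinite the bound only
    says something if [X] has variance zero; then [X] is constant [Q]-almost
    surely, hence also [P]-almost surely. *)

Lemma Lfun2_sqr_lty d (T : measurableType d) (R : realType)
    (mu : {measure set T -> \bar R}) (f : T -> R) :
  measurable_fun [set: T] f -> \int[mu]_x (f x ^+ 2)%:E < +oo ->
  f \in Lfun mu 2%:E.
Proof.
move=> mf f2; rewrite inE; apply/andP; split; rewrite inE//=.
rewrite /finite_norm unlock poweR_lty//.
under eq_integral do rewrite /= powR_mulrn// real_normK ?num_real//.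
by [].
Qed.

Section variance_facts.
Context d (T : measurableType d) (R : realType) (P : probability T R).

Lemma variance_integral (X : T -> R) :
  'V_P[X] = \int[P]_x ((X x - fine 'E_P[X]) ^+ 2)%:E.
Proof.
rewrite /variance covariance.unlock; set m := fine _.
by rewrite expectation.unlock.
Qed.

(** Finite variance makes the centred variable square-integrable, and adding the mean back keeps it
    so because constants are square-integrable under a probability. *)
Lemma Lfun2_has_variance (X : T -> R) : has_variance P X -> X \in Lfun P 2%:E.
Proof.
move=> [/measurable_int/measurable_EFinP mX VX].
have -> : X = ((X \- cst (fine 'E_P[X])) \+ cst (fine 'E_P[X]))%R.
  by apply/funext => x /=; rewrite subrK.
rewrite rpredD ?lee1n//= => [_|_]; last exact: Lfun_cst.
apply: Lfun2_sqr_lty; first exact: measurable_funB.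
by rewrite -variance_integral.
Qed.

Lemma variance0_ae (X : T -> R) : measurable_fun [set: T] X -> 'V_P[X] = 0 ->
  ae_eq P [set: T] (EFin \o X) (cst (fine 'E_P[X])%:E).
Proof.
move=> mX VX; set m := fine _.
have mf : measurable_fun [set: T] (fun x => ((X x - m) ^+ 2)%:E).
  by apply/measurable_EFinP/measurable_funX; exact: measurable_funB.
have /(ae_eq_integral_abs P measurableT mf) f0 :
    \int[P]_x `|((X x - m) ^+ 2)%:E| = 0.
  rewrite -[RHS]VX variance_integral.
  by apply: eq_integral => x _; rewrite gee0_abs ?lee_fin ?sqr_ge0.
apply: filterS f0 => x /= /[apply] -[] /eqP.
by rewrite sqrf_eq0 subr_eq0 => /eqP ->.
Qed.

End variance_facts.

Section density.
Context d (T : measurableType d) (R : realType) (P Q : probability T R).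
Hypothesis PQ : P `<< Q.

(** Made real-valued so that [covariance] and [Lfun] apply; [fine] loses nothing, the derivative
    being finite everywhere. *)
Definition density : T -> R :=
  fine \o Radon_Nikodym (charge_of_finite_measure P) Q.

Lemma EFin_density x :
  (density x)%:E = Radon_Nikodym (charge_of_finite_measure P) Q x.
Proof. by rewrite fineK// Radon_Nikodym_fin_num. Qed.

Lemma density_Lfun1 : density \in Lfun Q 1.
Proof.
apply/Lfun1_integrable; rewrite /comp (funext EFin_density).
exact: Radon_Nikodym_integrable.
Qed.

Lemma expectation_density : 'E_Q[density] = 1.
Proof.
rewrite unlock; under eq_integral do rewrite EFin_density.
rewrite -Radon_Nikodym_integral//=.
exact: probability_setT.
Qed.

Lemma variance_density : 'V_Q[density] = chi2_div P Q.
Proof.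
rewrite variance_integral expectation_density.
apply: eq_integral => x _; rewrite -EFin_density.
by rewrite -EFinB -EFin_expe.
Qed.

Lemma expectationM_density (X : T -> R) : measurable_fun [set: T] X ->
  (X * density)%R \in Lfun Q 1 -> 'E_Q[X * density] = 'E_P[X].
Proof.
move=> mX XY.
suff iX : P.-integrable [set: T] (EFin \o X).
  rewrite unlock -(Radon_Nikodym_change_of_variables PQ)//.
  by apply: eq_integral => x _; rewrite -EFin_density.
apply/integrableP; split; first exact/measurable_EFinP.
(* Integrability of [X] under [P] has to be derived from that of [X * density] under [Q]. The change
   of variables for nonnegative functions, applied to [|X|], does this; its derivative is
   nonnegative and agrees with [density] [Q]-almost everywhere. *)
rewrite -(Radon_Nikodym_SigmaFinite.change_of_variables PQ)//; last first.
  by apply/measurableT_comp => //; exact/measurable_EFinP.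
move/Lfun1_integrable/integrableP : XY => [mXY]; apply: le_lt_trans.
rewrite le_eqVlt; apply/orP; left; apply/eqP; apply: ae_eq_integral => //.
- apply: emeasurable_funM; first exact/measurableT_comp/measurable_EFinP.
  exact: measurable_int (Radon_Nikodym_SigmaFinite.f_integrable PQ).
- exact: measurableT_comp.
apply: filterS (ae_eq_Radon_Nikodym_SigmaFinite PQ measurableT).
move=> x /= /(_ Logic.I) fE _.
rewrite normrM EFinM; congr (_ * _).
rewrite -abse_EFin EFin_density -fE gee0_abs//.
exact: Radon_Nikodym_SigmaFinite.f_ge0.
Qed.

Lemma expectation_dist_le (X : T -> R) : has_variance Q X ->
  `|'E_P[X] - 'E_Q[X]| <= sqrte ('V_Q[X] * chi2_div P Q).
Proof.
move=> vX; have [iX VX] := vX.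
have mX : measurable_fun [set: T] X.
  exact/measurable_EFinP/(measurable_int Q).
have EQ : 'E_Q[X] \is a fin_num by exact/expectation_fin_num/Lfun1_integrable.
(* Treated first because [0 * +oo = 0]: here the bound is 0 even when the divergence is infinite. *)
have [V0|V0] := eqVneq 'V_Q[X] 0.
  suff -> : 'E_P[X] = 'E_Q[X] by rewrite subee// abse0 sqrte_ge0.
  have XP := null_dominates_ae_eq measurableT PQ (variance0_ae mX V0).
  rewrite -[RHS](fineK EQ); move: XP; set m := fine _ => XP.
  rewrite unlock (ae_eq_integral _ _ _ _ _ XP)//; last exact/measurable_EFinP.
  by rewrite integral_cst//= probability_setT mule1 fineK.
have [chioo|chioo] := eqVneq (chi2_div P Q) +oo.
  by rewrite chioo gt0_muley ?leey// lt0e V0 variance_ge0.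
have X2 := Lfun2_has_variance vX.
have Y1 := density_Lfun1.
have Y2 : density \in Lfun Q 2%:E.
  apply: Lfun2_has_variance; split; first exact/Lfun1_integrable.
  by rewrite variance_density ltey.
have X1 : X \in Lfun Q 1 by exact/Lfun1_integrable.
have XY := Lfun2_mul_Lfun1 X2 Y2.
have covE : covariance Q X density = 'E_P[X] - 'E_Q[X].
  by rewrite covarianceE// expectation_density mule1 expectationM_density.
rewrite sqrteM ?variance_ge0// -variance_density -covE.
(* [covariance_le] is one-sided; a negative covariance is handled by passing to [-X], which has the
   same variance. *)
have [/gee0_abs ->|/lte0_abs ->] := leP 0 (covariance Q X density).
  exact: covariance_le.
rewrite -(covarianceNl X1 Y1 XY).
by rewrite -(varianceN X2) covariance_le// rpredN.
Qed.

End density.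

Lemma gen_entropy_le d (Z : measurableType d) (R : realType) (A : Type)
    (loss : Z -> A -> R) (P : probability Z R) (a : A) :
  gen_entropy loss P <= 'E_P[loss ^~ a].
Proof. by apply: ereal_inf_lbound; exists a. Qed.

Theorem theorem3 (R : realType) (d : measure_display) (Z : measurableType d)
    (A : Type) (loss : Z -> A -> R)
    (mloss : forall a : A, measurable_fun [set: Z] (loss ^~ a))
    (P Q : probability Z R) (PQ : P `<< Q) (aP aQ : A)
    (haP : gen_entropy loss P = 'E_P[loss ^~ aP])
    (haQ : gen_entropy loss Q = 'E_Q[loss ^~ aQ])
    (varQ : has_variance Q (loss ^~ aQ))
    (varP : has_variance Q (loss ^~ aP)) :
  gen_entropy loss P - gen_entropy loss Q
    <= sqrte ('V_Q[loss ^~ aQ] * chi2_div P Q)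
  /\
  gen_entropy loss Q - gen_entropy loss P
    <= sqrte ('V_Q[loss ^~ aP] * chi2_div P Q).
Proof.
split.
  apply: le_trans (expectation_dist_le PQ varQ).
  by rewrite haQ (le_trans _ (lee_abs _))// leeB ?gen_entropy_le.
apply: le_trans (expectation_dist_le PQ varP).
(* Distributing the opposite must avoid [+oo - +oo]: the mean under [Q] is finite by [varP],
   whatever the one under [P]. *)
rewrite haP -abseN oppeB; last first.
  rewrite fin_num_adde_defl// fin_numN expectation_fin_num//.
  by apply/Lfun1_integrable; case: varP.
by rewrite [X in `|X|]addeC (le_trans _ (lee_abs _))// leeB ?gen_entropy_le.
Qed.
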